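(* Let $\mathcal{G}$ be a compact group acting continuously on a sample space $\mathcal{Y}$, equipped with a filtration $(\mathcal{I}_n)_{n\geq 0}$, and let $(\varepsilon_n)_{n \geq 0}$, $\varepsilon_n : \mathcal{Y} \to [0,\infty]$, be a stochastic process adapted to $(\mathcal{I}_n)_{n\geq 0}$. Then $(\varepsilon_n)_{n\geq 0}$ is anytime valid for $\mathcal{G}$ invariance if and only if $\varepsilon_\tau$ is valid for $\mathrm{Unif}(O)$, i.e. $\mathbb{E}^{\mathrm{Unif}(O)}[\varepsilon_\tau] \leq 1$, for every orbit $O \in \mathcal{Y}/\mathcal{G}$ and every stopping time $\tau$.
   Context: All spaces are second-countable locally compact Hausdorff, equipped with their Borel $\sigma$-algebras; $\mathcal{I}$ is the $\sigma$-algebra on $\mathcal{Y}$ and $\mathcal{I}_n \subseteq \mathcal{I}$, with $\mathcal{I}_0 = \{\emptyset,\mathcal{Y}\}$. Stopping times are with respect to $(\mathcal{I}_n)_{n \geq 0}$. The orbit of $y$ is $O_y = \{Gy : G \in \mathcal{G}\}$, and $\mathcal{Y}/\mathcal{G}$ is the set of orbits; $\mathrm{Unif}(O)$ is the law of $\overline{G}y$ for any $y \in O$, with $\overline{G}$ following the Haar probability measure on $\mathcal{G}$. A probability $\mathbb{P}$ on $\mathcal{Y}$ is $\mathcal{G}$ invariant if $\mathbb{P}(G^{-1}A) = \mathbb{P}(A)$ for all $G \in \mathcal{G}$ and events $A$. The process $(\varepsilon_n)_{n\geq0}$ is anytime valid for $\mathcal{G}$ invariance if, for every stopping time $\tau$,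 $\varepsilon_\tau$ is a valid e-value for $\mathcal{G}$ invariance, i.e. $\mathbb{E}^{\mathbb{P}}[\varepsilon_\tau] \leq 1$ for every $\mathcal{G}$ invariant probability $\mathbb{P}$. *)

(* Defs.v *)
From HB Require Import structures.
From mathcomp Require Import all_boot all_order all_algebra.
From mathcomp Require Import all_classical all_reals all_analysis measurable_realfun.
Set Implicit Arguments.
Unset Strict Implicit.
Unset Printing Implicit Defensive.
Import Order.TTheory GRing.Theory Num.Theory.
Import numFieldNormedType.Exports.

Local Open Scope classical_set_scope.
Local Open Scope ring_scope.
Local Open Scope ereal_scope.

Notation borel T := (g_sigma_algebraType (@open T)).

Definition lc2_hausdorff (T : topologicalType) : Prop :=
  [/\ @second_countable T, locally_compact [set: T] & hausdorff_space T].

(* Measurable types must be pointed, whence the (arbitrary) base point. *)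
HB.mixin Record PointedTopological_Group_isTopologicalGroup G
    of PointedTopological G & Group G := {
  mulg_continuous : continuous (fun x : G * G => (x.1 * x.2)%g) ;
  invg_continuous : continuous (fun x : G => (x^-1)%g) ;
}.

#[short(type="topologicalGroupType")]
HB.structure Definition TopologicalGroup :=
  {G of PointedTopological G & Group G
      & PointedTopological_Group_isTopologicalGroup G}.

Record continuous_action (G : topologicalGroupType) (Y : topologicalType) := {
  act_fun :> G -> Y -> Y ;
  act1 : forall y, act_fun 1%g y = y ;
  actM : forall g h y, act_fun (g * h)%g y = act_fun g (act_fun h y) ;
  act_continuous : continuous (fun p : G * Y => act_fun p.1 p.2) }.

Lemma countable_bigcup_measurable d (T : measurableType d) (U : choiceType)
    (D : set U) (F : U -> set T) :
  countable D -> (forall i, D i -> measurable (F i)) ->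
  measurable (\bigcup_(i in D) F i).
Proof.
move=> /countable_injP[f injf] mF.
have -> : \bigcup_(i in D) F i =
    \bigcup_n \bigcup_(i in D `&` f @^-1` [set n]) F i.
  apply/seteqP; split => x.
    by move=> [i Di Fx]; exists (f i) => //; exists i.
  by move=> [n _ [i [Di _] Fx]]; exists i.
apply: bigcupT_measurable => n.
have [[i [Di fi]]|nD] := pselect (exists i, (D `&` f @^-1` [set n]) i).
  rewrite (_ : \bigcup_(_ in _) _ = F i); first exact: mF.
  apply/seteqP; split => x; last by move=> Fx; exists i.
  move=> [j [Dj fj]]; rewrite (injf j i) ?inE//=.
  by rewrite [LHS]fj -fi.
rewrite bigcup0 ?measurable0// => i Di.
by case: nD; exists i.
Qed.

Lemma continuous_borel (X : ptopologicalType) (Z : ptopologicalType)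
    (f : X -> Z) :
  continuous f -> measurable_fun [set: borel X] (f : borel X -> borel Z).
Proof.
move=> /continuousP cf.
apply: (@measurability _ _ (borel X) (borel Z) _ _ (@open Z)) => //.
move=> _ [U oU <-]; rewrite setTI.
by apply: sub_sigma_algebra; exact: cf.
Qed.

(* On second countable spaces the product of the Borel sigma-algebras contains
   the open sets of the product. *)
Lemma continuous_prod_borel (X1 X2 Z : ptopologicalType) (f : X1 * X2 -> Z) :
  @second_countable X1 -> @second_countable X2 -> continuous f ->
  measurable_fun [set: borel X1 * borel X2]
    (f : borel X1 * borel X2 -> borel Z).
Proof.
move=> [B1 cB1 [oB1 bB1]] [B2 cB2 [oB2 bB2]] /continuousP cf.
apply: (@measurability _ _ (borel X1 * borel X2)%type (borel Z) _ _ (@open Z)) => //.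
move=> _ [U oU <-]; rewrite setTI.
have oV : open (f @^-1` U) by exact: cf.
set V := f @^-1` U in oV *.
pose D := [set P : set X1 * set X2 |
  [/\ B1 P.1, B2 P.2 & P.1 `*` P.2 `<=` V]].
have -> : V = \bigcup_(P in D) (P.1 `*` P.2).
  apply/seteqP; split => [[x1 x2] Vx|x [P [_ _ PV] Px]]; last exact: PV.
  move: oV; rewrite openE => /(_ _ Vx) [[/= P1 P2] [/= n1 n2] PV].
  have [W1 [BW1 Wx1] WP1] := bB1 _ _ n1.
  have [W2 [BW2 Wx2] WP2] := bB2 _ _ n2.
  exists (W1, W2) => //; split => //= -[a b] [/= Wa Wb].
  by apply: PV; split; [exact: WP1|exact: WP2].
apply: countable_bigcup_measurable.
  apply: (@sub_countable _ _ D (B1 `*` B2)); last exact: countableX.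
  by apply: subset_card_le => P [].
move=> P [BP1 BP2 _].
by apply: measurableX; apply: sub_sigma_algebra; [exact: oB1|exact: oB2].
Qed.

Section orbits.
Context (G : topologicalGroupType) (Y : ptopologicalType).
Variable act : continuous_action G Y.

Definition act_orbit (y : Y) : set Y := range (act^~ y).

Definition orbit_space : Type := {O : set Y | range act_orbit O}.

Definition orbit_repr (O : orbit_space) : Y := s2val (cid2 (proj2_sig O)).

Lemma orbit_reprE (O : orbit_space) : act_orbit (orbit_repr O) = proj1_sig O.
Proof. by rewrite /orbit_repr; case: cid2. Qed.

Definition orbit_map (y : Y) : borel G -> borel Y := act^~ y.

Lemma measurable_orbit_map y : measurable_fun [set: borel G] (orbit_map y).
Proof.
apply: continuous_borel => g.
apply: (@continuous_comp _ _ _ (fun g => (g, y)) (fun p : G * Y => act p.1 p.2)).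
  by apply: cvg_pair => /=; [exact: cvg_id|exact: cvg_cst].
exact: act_continuous.
Qed.

HB.instance Definition _ y := isMeasurableFun.Build _ _ (borel G) (borel Y)
  (orbit_map y) (measurable_orbit_map y).

End orbits.

Section invariance.
Context (R : realType) (G : topologicalGroupType) (Y : ptopologicalType).
Variable act : continuous_action G Y.

Definition is_haar (mu : probability (borel G) R) : Prop :=
  forall (g : G) (A : set (borel G)), measurable A ->
    mu [set (g * h)%g | h in A] = mu A.

(* The law is computed at a chosen point of the orbit; by unif_orbitE it does
   not depend on this point. *)
Definition unif_orbit (haar : probability (borel G) R)
    (O : orbit_space act) : probability (borel Y) R :=
  distribution haar (orbit_map act (orbit_repr O)).

Definition invariant_probability (P : probability (borel Y) R) : Prop :=
  forall (g : G) (A : set (borel Y)), measurable A -> P (act g @^-1` A) = P A.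

Definition valid_evalue (P : probability (borel Y) R) (e : Y -> \bar R) : Prop :=
  \int[P]_y e y <= 1.

Definition valid_for_invariance (e : Y -> \bar R) : Prop :=
  forall P : probability (borel Y) R, invariant_probability P -> valid_evalue P e.

End invariance.

Section processes.
Context (R : realType) (Y : ptopologicalType).

Record filtration (I : (set (set Y))^nat) : Prop := {
  filtration_sigma_algebra : forall n, sigma_algebra [set: Y] (I n) ;
  filtration_measurable : forall n, I n `<=` @measurable _ (borel Y) ;
  filtration_le : forall m n, (m <= n)%N -> I m `<=` I n ;
  filtration0 : I 0%N = [set set0; [set: Y]] }.

Definition adapted (I : (set (set Y))^nat) (eps : (Y -> \bar R)^nat) : Prop :=
  forall n B, measurable B -> I n (eps n @^-1` B).

(* Finite-valued: eps has no value at time +oo. *)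
Definition stopping_time (I : (set (set Y))^nat) (tau : Y -> nat) : Prop :=
  forall n, I n [set y | (tau y <= n)%N].

Definition stopped (eps : (Y -> \bar R)^nat) (tau : Y -> nat) : Y -> \bar R :=
  fun y => eps (tau y) y.

Definition anytime_valid (G : topologicalGroupType)
    (act : continuous_action G Y) (I : (set (set Y))^nat)
    (eps : (Y -> \bar R)^nat) : Prop :=
  forall tau, stopping_time I tau -> valid_for_invariance act (stopped eps tau).

End processes.

Section haar_theory.
Context (R : realType) (G : topologicalGroupType).
Variable mu : probability (borel G) R.
Hypotheses (scG : @second_countable G) (mu_haar : is_haar mu).

Let lmulE (g : G) (A : set G) :
  [set (g * h)%g | h in A] = [set h | A (g^-1 * h)%g].
Proof.
apply/seteqP; split => x /=.
  by move=> [h Ah <-]; rewrite mulKg.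
by move=> Ah; exists (g^-1 * x)%g => //; rewrite mulgA mulgV mul1g.
Qed.

Let measurable_lmul (g : G) (A : set (borel G)) :
  measurable A -> measurable ([set h | A (g * h)%g] : set (borel G)).
Proof.
move=> mA; rewrite -[X in measurable X]setTI.
have : continuous (fun h : G => (g * h)%g); last by move/continuous_borel; apply.
move=> h; apply: (@continuous_comp _ _ _ (fun h => (g, h)) (fun p : G * G => (p.1 * p.2)%g)).
  by apply: cvg_pair => /=; [exact: cvg_cst|exact: cvg_id].
exact: mulg_continuous.
Qed.

Let measurable_inv (A : set (borel G)) :
  measurable A -> measurable ([set h | A (h^-1)%g] : set (borel G)).
Proof.
move=> mA; rewrite -[X in measurable X]setTI.
by have /continuous_borel := @invg_continuous G; apply.
Qed.

Lemma haar_lmul (g : G) (A : set (borel G)) : measurable A ->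
  mu [set h | A (g * h)%g] = mu A.
Proof.
by move=> mA; rewrite -{1}[g]invgK -lmulE mu_haar.
Qed.

Lemma haar_inv (A : set (borel G)) : measurable A ->
  mu [set h | A (h^-1)%g] = mu A.
Proof.
move=> mA.
pose S : set (borel G * borel G) := [set p | A (p.1^-1 * p.2)%g].
have mS : measurable S.
  rewrite -[X in measurable X]setTI.
  have : continuous (fun p : G * G => (p.1^-1 * p.2)%g); last first.
    by move/(continuous_prod_borel scG scG); apply.
  move=> p.
  apply: (@continuous_comp _ _ _ (fun p : G * G => ((p.1^-1)%g, p.2))
    (fun p : G * G => (p.1 * p.2)%g)); last exact: mulg_continuous.
  apply: cvg_pair => /=; last exact: cvg_snd.
  apply: (@continuous_comp _ _ _ fst (fun x : G => (x^-1)%g)); first exact: cvg_fst.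
  exact: invg_continuous.
have := indic_fubini_tonelli mu mu mS.
rewrite (indic_fubini_tonelli_FE mu mS) (indic_fubini_tonelli_GE mu mS).
rewrite (_ : mu \o xsection S = cst (mu A)); last first.
  apply/funext => g /=.
  rewrite -[RHS](haar_lmul (g^-1)%g mA); congr (mu _).
  by apply/seteqP; split => h; rewrite /xsection/= inE.
rewrite (_ : mu \o ysection S = cst (mu [set h | A (h^-1)%g])); last first.
  apply/funext => g /=.
  rewrite -[RHS](haar_lmul (g^-1)%g (measurable_inv mA)); congr (mu _).
  by apply/seteqP; split => h; rewrite /ysection/= inE /S/= invgM invgK.
rewrite !integral_cst// => muE.
by rewrite -[LHS]mule1 -[RHS]mule1 -(probability_setT mu); exact: esym muE.
Qed.

Lemma haar_rmul (g : G) (A : set (borel G)) : measurable A ->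
  mu [set h | A (h * g)%g] = mu A.
Proof.
move=> mA; rewrite -(haar_inv mA).
rewrite -(haar_lmul (g^-1)%g (measurable_inv mA)) /=.
rewrite -[RHS]haar_inv; last exact: measurable_lmul (measurable_inv mA).
by congr (mu _); apply/seteqP; split => h /=; rewrite invgM !invgK.
Qed.

Lemma unif_orbitE (Y : ptopologicalType) (act : continuous_action G Y)
    (O : orbit_space act) (y : Y) (A : set (borel Y)) :
  proj1_sig O y -> measurable A ->
  unif_orbit mu O A = mu [set g | A (act g y)].
Proof.
rewrite -orbit_reprE => -[g _ gy] mA.
transitivity (mu [set h | A (act h (orbit_repr O))]); first by [].
rewrite -(@haar_rmul g [set h | A (act h (orbit_repr O))]).
  by congr (mu _); apply/seteqP; split => h /=; rewrite actM gy.
rewrite -[X in measurable X]setTI.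
exact: (measurable_orbit_map act (orbit_repr O)).
Qed.

End haar_theory.

(* Main.v *)
Require Import Defs.
From HB Require Import structures.
From mathcomp Require Import all_boot all_order all_algebra.
From mathcomp Require Import all_classical all_reals all_analysis measurable_realfun.
Local Open Scope classical_set_scope.
Local Open Scope ring_scope.
Local Open Scope ereal_scope.

(** Both directions are statements about the single nonnegative Borel function
    [e = stopped eps tau]; the process only enters through the measurability
    of [e] ([measurable_stopped]).

    The uniform law on an orbit is itself an invariant probability, because
    Haar measure is ([invariant_unif_orbit]); hence validity under every
    invariant probability contains validity on every orbit.

    Conversely, every invariant probability [P] is a mixture of uniform laws on
    orbits, the mixing measure being [P] itself ([integral_invariant_orbits]).
    Moving the sample by a fixed [g] does not change the expectation of [e]
    under [P], so nor does moving it by a Haar-random [g]; exchanging the two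
    integrals by Tonelli leaves, for each sample point [y], the expectation of
    [e] under the uniform law on the orbit of [y].  If all these are at most
    [1], so is their [P]-average. *)

Lemma measurable_stopped (R : realType) (Y : ptopologicalType)
    (I : (set (set Y))^nat) (eps : (Y -> \bar R)^nat) (tau : Y -> nat) :
  filtration I -> adapted I eps -> stopping_time I tau ->
  measurable_fun [set: borel Y] (stopped eps tau : borel Y -> \bar R).
Proof.
move=> filtI adI stau _ B mB; rewrite setTI.
have mI n A : I n A -> measurable (A : set (borel Y)).
  exact: filtration_measurable.
have mle n : measurable ([set y | (tau y <= n)%N] : set (borel Y)).
  exact: mI (stau n).
have meq n : measurable ([set y | tau y = n] : set (borel Y)).
  case: n => [|n].
    rewrite (_ : [set _ | _] = [set y | (tau y <= 0)%N]); first exact: mle.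
    by apply/seteqP; split => y /=; rewrite leqn0 => /eqP.
  rewrite (_ : [set _ | _] =
      [set y | (tau y <= n.+1)%N] `\` [set y | (tau y <= n)%N]).
    exact: measurableD.
  apply/seteqP; split => y /=; first by move=> ->; rewrite ltnn.
  by case=> le_n1 /negP; rewrite -ltnNge => lt_n; apply/eqP; rewrite eqn_leq le_n1.
have -> : stopped eps tau @^-1` B =
    \bigcup_n ([set y | tau y = n] `&` eps n @^-1` B).
  apply/seteqP; split => y; first by move=> By; exists (tau y).
  by move=> [n _ [/= <-]].
apply: bigcupT_measurable => n; apply: measurableI; first exact: meq.
exact: mI (adI _ _ mB).
Qed.

Section orbit_mixture.
Set Implicit Arguments.
Context (R : realType) (G : topologicalGroupType) (Y : ptopologicalType).
Variable act : continuous_action G Y.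

Definition orbit_of (y : Y) : orbit_space act :=
  exist _ (act_orbit act y) (ex_intro2 _ _ y Logic.I erefl).

Lemma orbit_of_refl y : proj1_sig (orbit_of y) y.
Proof. by exists 1%g => //=; rewrite act1. Qed.

Lemma measurable_act (g : G) :
  measurable_fun [set: borel Y] (act g : borel Y -> borel Y).
Proof.
apply: continuous_borel => y.
apply: (@continuous_comp _ _ _ (fun y => (g, y)) (fun p : G * Y => act p.1 p.2)).
  by apply: cvg_pair => /=; [exact: cvg_cst|exact: cvg_id].
exact: act_continuous.
Qed.

(** If [h] is Haar distributed then so is [g * h], whence [act g (act h y)] and
    [act h y] have the same law. *)
Lemma invariant_unif_orbit (haar : probability (borel G) R)
    (O : orbit_space act) :
  is_haar haar -> invariant_probability act (unif_orbit haar O).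
Proof.
move=> haarP g A mA.
have mO : measurable (orbit_map act (orbit_repr O) @^-1` A).
  by rewrite -[X in measurable X]setTI; exact: measurable_orbit_map.
rewrite [RHS](_ : _ = haar (orbit_map act (orbit_repr O) @^-1` A)) //.
rewrite -(haar_lmul haarP g mO).
by congr (haar _); apply/seteqP; split => h; rewrite /= /orbit_map/= actM.
Qed.

(** The uniform law is defined from a chosen representative of the orbit; right
    invariance of Haar measure, through [unif_orbitE], lets [y] itself take that
    role, which makes the integrand jointly measurable in [g] and [y]
    although the choice of representatives need not be. *)
Lemma integral_unif_orbit (haar : probability (borel G) R) (y : Y)
    (e : Y -> \bar R) :
  @second_countable G -> is_haar haar ->
  measurable_fun [set: borel Y] (e : borel Y -> \bar R) ->
  (forall y, 0 <= e y) ->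
  \int[unif_orbit haar (orbit_of y)]_x e x = \int[haar]_g e (act g y).
Proof.
move=> scG haarP me e0.
rewrite -[RHS](ge0_integral_distribution (orbit_map act y) me e0).
by apply: eq_measure_integral => A mA _; exact: (unif_orbitE scG haarP (orbit_of_refl y) mA).
Qed.

Lemma integral_invariant (P : probability (borel Y) R) (g : G)
    (e : Y -> \bar R) :
  invariant_probability act P ->
  measurable_fun [set: borel Y] (e : borel Y -> \bar R) ->
  (forall y, 0 <= e y) ->
  \int[P]_y e (act g y) = \int[P]_y e y.
Proof.
move=> Pinv me e0.
pose a : {mfun borel Y >-> borel Y} := mfun_Sub (mem_set (measurable_act g)).
rewrite -[LHS](ge0_integral_distribution (P := P) a me e0).
by apply: eq_measure_integral => A mA _; exact: Pinv.
Qed.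

(** Second countability matters here: it is what puts the open sets of [G * Y]
    in the product of the two Borel sigma-algebras, so that [e] along the
    action is measurable for the sigma-algebra of Tonelli's theorem. *)
Lemma measurable_comp_action (e : Y -> \bar R) :
  @second_countable G -> @second_countable Y ->
  measurable_fun [set: borel Y] (e : borel Y -> \bar R) ->
  measurable_fun [set: borel G * borel Y]
    ((fun p => e (act p.1 p.2)) : borel G * borel Y -> \bar R).
Proof.
move=> scG scY me.
have mact := continuous_prod_borel scG scY (@act_continuous _ _ act).
exact: (measurableT_comp me mact).
Qed.

Lemma measurable_integral_unif_orbit (haar : probability (borel G) R)
    (e : Y -> \bar R) :
  @second_countable G -> @second_countable Y -> is_haar haar ->
  measurable_fun [set: borel Y] (e : borel Y -> \bar R) ->
  (forall y, 0 <= e y) ->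
  measurable_fun [set: borel Y]
    ((fun y => \int[unif_orbit haar (orbit_of y)]_x e x) : borel Y -> \bar R).
Proof.
move=> scG scY haarP me e0.
have mF := measurable_comp_action scG scY me.
rewrite (_ : (fun y => _) = fubini_G haar
    ((fun p => e (act p.1 p.2)) : borel G * borel Y -> \bar R)).
  by apply: measurable_fun_fubini_tonelli_G => // p; exact: e0.
by apply/funext => y; rewrite integral_unif_orbit.
Qed.

(** Average the invariance identity [integral_invariant] over a Haar-random
    [g] and exchange the integrals. *)
Lemma integral_invariant_orbits (haar : probability (borel G) R)
    (P : probability (borel Y) R) (e : Y -> \bar R) :
  @second_countable G -> @second_countable Y -> is_haar haar ->
  invariant_probability act P ->
  measurable_fun [set: borel Y] (e : borel Y -> \bar R) ->
  (forall y, 0 <= e y) ->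
  \int[P]_y e y = \int[P]_y \int[unif_orbit haar (orbit_of y)]_x e x.
Proof.
move=> scG scY haarP Pinv me e0.
under [RHS]eq_integral do rewrite integral_unif_orbit//.
have mF := measurable_comp_action scG scY me.
rewrite -(fubini_tonelli (m1 := haar) (m2 := P) _ mF) //=.
under [RHS]eq_integral do rewrite integral_invariant//.
rewrite -[LHS]mule1 -(probability_setT haar).
by rewrite -(integral_cst haar measurableT).
Qed.

End orbit_mixture.

Theorem theorem7 (R : realType)
    (G : topologicalGroupType) (compG : compact [set: G])
    (spaceG : lc2_hausdorff G)
    (Y : ptopologicalType) (spaceY : lc2_hausdorff Y)
    (act : continuous_action G Y)
    (haar : probability (borel G) R) (haarP : is_haar haar)
    (I : (set (set Y))^nat) (filtI : filtration I)
    (eps : (Y -> \bar R)^nat) (eps_ge0 : forall n y, 0 <= eps n y)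
    (adapted_eps : adapted I eps) :
  anytime_valid act I eps <->
  (forall (O : orbit_space act) (tau : Y -> nat), stopping_time I tau ->
     valid_evalue (unif_orbit haar O) (stopped eps tau)).
Proof.
have [scG _ _] := spaceG; have [scY _ _] := spaceY.
split=> [valid O tau stau|valid tau stau P Pinv].
  exact: valid (invariant_unif_orbit O haarP).
have me := measurable_stopped R Y I eps tau filtI adapted_eps stau.
have e0 y : 0 <= stopped eps tau y by exact: eps_ge0.
rewrite /valid_evalue (integral_invariant_orbits scG scY haarP Pinv me e0).
rewrite -[leRHS](_ : \int[P]_y 1 = 1); last first.
  by rewrite (integral_cst P measurableT) mul1e; exact: probability_setT.
apply: ge0_le_integral => //.
- by move=> y _; apply: integral_ge0 => x _; exact: e0.
- exact: (measurable_integral_unif_orbit act scG scY haarP me e0).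
- by move=> y _; exact: valid.
Qed.
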